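(* Let $s\ge1$. The $s$-stage HSAV Gaussian collocation method (defined in the context) is unconditionally energy stable: for every time step $\Delta t>0$, every given $(\phi^n,q^n)$, and all collocation polynomials $u,v$ of the method with resulting $(\phi^{n+1},q^{n+1})$, $$E^{n+1}-E^n=\Delta t\sum_{i=1}^s b_i\Big(\mathcal L u(t_n^i)+\frac{v(t_n^i)\,g'(u(t_n^i))}{\sqrt{(g(u(t_n^i)),1)+C_0}},\ \mathcal G\Big[\mathcal L u(t_n^i)+\frac{v(t_n^i)\,g'(u(t_n^i))}{\sqrt{(g(u(t_n^i)),1)+C_0}}\Big]\Big)\le 0,$$ where $E^{m}=\frac12(\mathcal L\phi^{m},\phi^{m})+(q^{m})^2-C_0$ for $m=n,n+1$, $t_n^i=t_n+c_i\Delta t$, $c_1,\dots,c_s$ are the Gaussian quadrature nodes on $[0,1]$, and $b_i\ge0$ ($i=1,\dots,s$) are the Gauss–Legendre quadrature weights on $[0,1]$.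
   Context: Setting. $\Omega$ is a spatial domain (periodic boundary conditions are assumed), $(f,h)=\int_\Omega f h\,d\mathbf x$ is the real $L^2(\Omega)$ inner product. $\mathcal L$ is a linear self-adjoint operator, $(\mathcal L\phi,\psi)=(\phi,\mathcal L\psi)$, and $\mathcal G$ is a negative semi-definite operator, $(\psi,\mathcal G\psi)\le 0$, for all $\phi,\psi$ in the relevant domains in $L^2(\Omega)$. $g:\mathbb R\to\mathbb R$ is a differentiable function with derivative $g'$ (applied pointwise to functions on $\Omega$), and $C_0>0$ is a constant with $(g(\phi),1)+C_0>0$ for all $\phi$ considered. All functions are real-valued and regular enough for the expressions to make sense: the polynomial $u$ in $t$ has coefficients in the domain of $\mathcal L$ (a linear subspace of $L^2(\Omega)$ on which the symmetry identity holds), $g(u(t_n^i))\in L^1(\Omega)$, $g'(u(t_n^i))\in L^2(\Omega)$, and the functions to which $\mathcal G$ is applied lie in the domain of $\mathcal G$, with values in $L^2(\Omega)$. The underlying system (scalar auxiliary variable reformulation of the gradient flow $\partial_t\phi=\mathcal G(\mathcal L\phi+g'(\phi))$) is $$\partial_t\phi=\mathcal G\Big(\mathcal L\phi+\frac{q g'(\phi)}{\sqrt{(g(\phi),1)+C_0}}\Big),\qquad \partial_t q=\Big(\frac{g'(\phi)}{2\sqrt{(g(\phi),1)+C_0}},\partial_t\phi\Big),$$ with $\phi=\phi(\mathbf x,t)$ and $q=q(t)\in\mathbb R$. $s$-stage HSAV collocation method. Let $c_1,\dots,c_s\in[0,1]$ be distinct and $t_n^i=t_n+c_i\Delta t$.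 Given $(\phi^n,q^n)$, the collocation polynomials $u(t)$ (function-valued) and $v(t)$ (real-valued) are polynomials in $t$ of degree (at most) $s$ satisfying $u(t_n)=\phi^n$, $v(t_n)=q^n$ and, for $i=1,\dots,s$, $$\partial_t u(t_n^i)=\mathcal G\Big(\mathcal L u(t_n^i)+\frac{v(t_n^i)g'(u(t_n^i))}{\sqrt{(g(u(t_n^i)),1)+C_0}}\Big),\qquad \partial_t v(t_n^i)=\Big(\frac{g'(u(t_n^i))}{2\sqrt{(g(u(t_n^i)),1)+C_0}},\partial_t u(t_n^i)\Big).$$ The numerical solution is $\phi^{n+1}=u(t_n+\Delta t)$, $q^{n+1}=v(t_n+\Delta t)$. The method is called the Gaussian collocation method when $c_1,\dots,c_s$ are the Gaussian quadrature nodes on $[0,1]$, i.e. the zeros of the $s$-th shifted Legendre polynomial $\frac{d^s}{dx^s}\big(x^s(x-1)^s\big)$; the corresponding Gauss–Legendre weights are the weights $b_i$ of the interpolatory quadrature formula $\int_0^1 f(x)\,dx\approx\sum_{i=1}^s b_i f(c_i)$. *)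

(* Defs.v *)
From HB Require Import structures.
From mathcomp Require Import all_boot all_order all_algebra.
From mathcomp Require Import all_classical all_reals all_analysis.

Set Implicit Arguments.
Unset Strict Implicit.
Unset Printing Implicit Defensive.

Import Order.TTheory GRing.Theory Num.Theory.
Import numFieldNormedType.Exports.

Local Open Scope classical_set_scope.
Local Open Scope ring_scope.

(* The spatial domain Omega with its volume is a measure space (T, mu); a
   periodic box is one instance.  An element of L^2(Omega) is represented by a
   function in [Lfun mu 2%:E], and equality in L^2(Omega) is equality
   mu-almost everywhere. *)

Section L2.
Context {R : realType} {d : measure_display} {T : measurableType d}.
Variable mu : {measure set T -> \bar R}.

Definition inner (f h : T -> R) : R := \int[mu]_x (f x * h x).

(* A partial operator on L^2(Omega) with domain D: the last two fields say that
   D and A depend only on classes modulo almost-everywhere equality. *)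
Record L2_operator (D : set (T -> R)) (A : (T -> R) -> T -> R) : Prop := {
  L2_operator_dom : forall f, D f -> f \in Lfun mu 2%:E;
  L2_operator_val : forall f, D f -> A f \in Lfun mu 2%:E;
  L2_operator_dom_ae : forall f h, D f -> h \in Lfun mu 2%:E ->
    f = h %[ae mu] -> D h;
  L2_operator_val_ae : forall f h, D f -> D h ->
    f = h %[ae mu] -> A f = A h %[ae mu] }.

Record linear_operator (D : set (T -> R)) (A : (T -> R) -> T -> R) : Prop := {
  linear_operator_dom0 : D (fun=> 0);
  linear_operator_dom : forall (a : R) f h, D f -> D h ->
    D (fun x => a * f x + h x);
  linear_operatorP : forall (a : R) f h, D f -> D h ->
    A (fun x => a * f x + h x) = (fun x => a * A f x + A h x) %[ae mu] }.

Definition self_adjoint (D : set (T -> R)) (A : (T -> R) -> T -> R) : Prop :=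
  forall f h, D f -> D h -> inner (A f) h = inner f (A h).

Definition negative_semidefinite (D : set (T -> R))
    (A : (T -> R) -> T -> R) : Prop :=
  forall f, D f -> inner f (A f) <= 0.

End L2.

Section quadrature.
Context {R : realType}.

Definition shifted_legendre (s : nat) : {poly R} :=
  ('X^s * ('X - 1%:P) ^+ s)^`(s).

(* c enumerates, without repetition, the zeros of the Legendre polynomial *)
Definition gauss_nodes (s : nat) (c : 'I_s -> R) : Prop :=
  injective c /\
  forall x, root (shifted_legendre s) x <-> exists i, c i = x.

(* integral over [0, 1] of the i-th Lagrange basis polynomial *)
Definition quadrature_weight (s : nat) (c : 'I_s -> R) (i : 'I_s) : R :=
  \int[@lebesgue_measure R]_(x in `[0, 1])
    \prod_(j < s | j != i) ((x - c j) / (c i - c j)).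

End quadrature.

Section HSAV.
Context {R : realType} {d : measure_display} {T : measurableType d}.
Variable mu : {measure set T -> \bar R}.
Variables (DL : set (T -> R)) (L : (T -> R) -> T -> R).
Variables (DG : set (T -> R)) (G : (T -> R) -> T -> R).
Variables (g : R -> R) (C0 : R).

Definition sav_root (phi : T -> R) : R :=
  Num.sqrt (inner mu (g \o phi) (fun=> 1) + C0).

Definition chemical_potential (phi : T -> R) (q : R) : T -> R :=
  fun x => L phi x + q * derive1 g (phi x) / sav_root phi.

Definition energy (phi : T -> R) (q : R) : R :=
  2^-1 * inner mu (L phi) phi + q ^+ 2 - C0.

(* u is a polynomial in time of degree at most s with coefficients in D *)
Definition time_polynomial (D : set (T -> R)) (s : nat) (u : R -> T -> R)
    : Prop :=
  exists a : 'I_s.+1 -> T -> R, (forall k, D (a k)) /\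
    forall t x, u t x = \sum_(k < s.+1) t ^+ k * a k x.

Definition dt_fun (u : R -> T -> R) (t : R) : T -> R :=
  fun x => derive1 (u ^~ x) t.

Definition stage (tn dt : R) (s : nat) (c : 'I_s -> R) (i : 'I_s) : R :=
  tn + c i * dt.

Record hsav_collocation (s : nat) (c : 'I_s -> R) (tn dt : R)
    (phin : T -> R) (qn : R) (u : R -> T -> R) (v : {poly R}) : Prop := {
  hsav_nodes_inj : injective c;
  hsav_nodes_itv : forall i, 0 <= c i <= 1;
  hsav_u_poly : time_polynomial DL s u;
  hsav_v_poly : (size v <= s.+1)%N;
  hsav_u_init : u tn = phin %[ae mu];
  hsav_v_init : v.[tn] = qn;
  hsav_g_L1 : forall i,
    mu.-integrable [set: T] (EFin \o (g \o u (stage tn dt c i)));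
  hsav_dg_L2 : forall i, derive1 g \o u (stage tn dt c i) \in Lfun mu 2%:E;
  hsav_C0 : forall i,
    0 < inner mu (g \o u (stage tn dt c i)) (fun=> 1) + C0;
  hsav_dom : forall i, let t := stage tn dt c i in
    DG (chemical_potential (u t) v.[t]);
  hsav_u_eq : forall i, let t := stage tn dt c i in
    dt_fun u t = G (chemical_potential (u t) v.[t]) %[ae mu];
  hsav_v_eq : forall i, let t := stage tn dt c i in
    v^`().[t] =
    inner mu (fun x => derive1 g (u t x) / (2 * sav_root (u t))) (dt_fun u t) }.

End HSAV.

(* Main.v *)
Require Import Defs.
From HB Require Import structures.
From mathcomp Require Import all_boot all_order all_algebra.
From mathcomp Require Import all_classical all_reals all_analysis.
From mathcomp Require Import measurable_realfun ring zify.
Import Order.TTheory GRing.Theory Num.Theory.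
Import numFieldNormedType.Exports.
Local Open Scope classical_set_scope.
Local Open Scope ring_scope.

(** Since u and v have degree at most s in t, the energy of (u t, v t) is a real
    polynomial in t of degree at most 2s, and its increment over a step is the
    integral of its derivative, of degree at most 2s - 1.  The s-point Gauss
    quadrature is exact on that derivative.  At a node, self-adjointness of L
    and the collocation equation for v turn the derivative into the inner
    product of w with u', where w is the chemical potential, and u' = G w there.
    The weights are nonnegative because the square of the i-th Lagrange basis
    polynomial has degree 2s - 2, so its integral is the i-th weight. *)

(** * Integrals of polynomials over the unit interval *)

Section poly_integral.
Context {R : realType}.
Implicit Types (p q : {poly R}) (a : R).

Definition poly_int01 p : R := \int[@lebesgue_measure R]_(x in `[0, 1]) p.[x].

Lemma integrable_horner01 p :
  (@lebesgue_measure R).-integrable `[0, 1] (EFin \o horner p).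
Proof.
apply: continuous_compact_integrable; first exact: segment_compact.
by apply: continuous_subspaceT; exact: continuous_horner.
Qed.

Lemma poly_int01D p q : poly_int01 (p + q) = poly_int01 p + poly_int01 q.
Proof.
rewrite /poly_int01 -RintegralD//; try exact: integrable_horner01.
by apply: eq_Rintegral => x _; rewrite hornerD.
Qed.

Lemma poly_int01Z a p : poly_int01 (a *: p) = a * poly_int01 p.
Proof.
rewrite /poly_int01 -RintegralZl//; last exact: integrable_horner01.
by apply: eq_Rintegral => x _; rewrite hornerZ.
Qed.

Lemma poly_int010 : poly_int01 0 = 0.
Proof. by rewrite -(scale0r 0) poly_int01Z mul0r. Qed.

Lemma poly_int01_sum (I : Type) (s : seq I) (P : pred I) (F : I -> {poly R}) :
  poly_int01 (\sum_(i <- s | P i) F i) = \sum_(i <- s | P i) poly_int01 (F i).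
Proof. exact: (big_morph _ poly_int01D poly_int010). Qed.

Lemma poly_int01_ge0 p : (forall x, 0 <= p.[x]) -> 0 <= poly_int01 p.
Proof. by move=> p_ge0; exact: Rintegral_ge0. Qed.

Lemma poly_int01_deriv p : poly_int01 p^`() = p.[1] - p.[0].
Proof.
rewrite /poly_int01 /Rintegral (@continuous_FTC2 _ _ (horner p))//.
- by apply: continuous_subspaceT; exact: continuous_horner.
- split.
  + by move=> x _; exact: derivable_horner.
  + by apply: cvg_at_right_filter; exact: continuous_horner.
  + by apply: cvg_at_left_filter; exact: continuous_horner.
- by move=> x _; rewrite derivE.
Qed.

End poly_integral.

(** * Degree and orthogonality of the shifted Legendre polynomials *)

Section legendre.
Context {R : realType}.
Implicit Types (p q : {poly R}) (s : nat).

(** By the product rule, each differentiation costs at most one factor ['X - a%:P]. The cofactor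
    stays unspecified: the lemma serves to make derivatives vanish at [a]. *)
Lemma derivn_exp_factor (a : R) p m j : (j <= m)%N ->
  exists r, (('X - a%:P) ^+ m * p)^`(j) = ('X - a%:P) ^+ (m - j) * r.
Proof.
elim: j => [_|j IHj ltjm]; first by exists p; rewrite subn0.
have [r Er] := IHj (ltnW ltjm).
rewrite derivnS Er subnS.
have : (0 < m - j)%N by rewrite subn_gt0.
case: (m - j)%N => // k _ /=; exists (r *+ k.+1 + ('X - a%:P) * r^`()).
rewrite derivM deriv_exp derivXsubC /= exprS; ring.
Qed.

(** The polynomial being differentiated is monic of degree 2s. Its leading coefficient moves to
    index s, multiplied by a falling factorial, which is nonzero in characteristic 0. *)
Lemma size_shifted_legendre s : size (shifted_legendre s : {poly R}) = s.+1.
Proof.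
rewrite /shifted_legendre; set P := 'X^s * _.
have mP : P \is monic by rewrite monicMl ?monicXn// monic_exp// monicXsubC.
have sP : size P = (s + s).+1.
  rewrite size_monicM ?monicXn//; last first.
    by rewrite expf_neq0// polyXsubC_eq0.
  by rewrite size_polyXn size_exp_XsubC addSn /= addnS.
apply/eqP; rewrite eqn_leq; apply/andP; split.
  apply/leq_sizeP => j ltsj; rewrite coef_derivn nth_default ?mul0rn//.
  by rewrite sP; lia.
apply: contraT; rewrite -ltnNge ltnS => /leq_sizeP/(_ s (leqnn s)).
rewrite coef_derivn; move/monicP: mP; rewrite lead_coefE sP /= => ->.
move/eqP; rewrite pnatr_eq0 -[_ == _]negbK -lt0n ffact_gt0.
by rewrite leq_addr.
Qed.

(* Repeated integration by parts: the boundary terms vanish because 0 and 1 are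
   roots of multiplicity s of X^s (X - 1)^s. *)
Lemma shifted_legendre_orthogonal s q :
  (size q <= s)%N -> poly_int01 (q * shifted_legendre s) = 0.
Proof.
rewrite /shifted_legendre; set P := 'X^s * _.
(* The size bound is tied to [j]: moving one derivative onto the test polynomial lowers both by one,
   and at [j = 0] that polynomial is zero. *)
suff H j : (j <= s)%N -> forall q, (size q <= j)%N ->
    poly_int01 (q * P^`(j)) = 0 by exact: (H s (leqnn s)).
elim: j => [_ r|j IHj ltjs r sr].
  by rewrite leqn0 size_poly_eq0 => /eqP ->; rewrite mul0r poly_int010.
have P1 : P^`(j).[1] = 0.
  rewrite /P mulrC; have [e ->] := derivn_exp_factor 1 'X^s _ _ (ltnW ltjs).
  by rewrite hornerM horner_exp hornerXsubC subrr expr0n subn_eq0 leqNgt ltjs mul0r.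
have P0 : P^`(j).[0] = 0.
  have -> : P = ('X - 0%:P) ^+ s * ('X - 1%:P) ^+ s by rewrite subr0.
  have [e ->] := derivn_exp_factor 0 (('X - 1%:P) ^+ s) _ _ (ltnW ltjs).
  by rewrite hornerM horner_exp hornerXsubC subrr expr0n subn_eq0 leqNgt ltjs mul0r.
have -> : r * P^`(j.+1) = (r * P^`(j))^`() + (-1) *: (r^`() * P^`(j)).
  by rewrite derivM derivnS scaleN1r addrAC subrr add0r.
rewrite poly_int01D poly_int01Z poly_int01_deriv !hornerM P0 P1 !mulr0 subrr.
rewrite IHj ?mulr0 ?addr0// ?(ltnW ltjs)//.
have [->|r0] := eqVneq r 0; first by rewrite deriv0 size_poly0.
by rewrite -ltnS (leq_trans (lt_size_deriv r0)).
Qed.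

End legendre.

(** * Lagrange interpolation and Gauss quadrature *)

Section gauss.
Context {R : realType}.
Variables (s : nat) (c : 'I_s -> R).
Hypothesis cG : gauss_nodes c.

(** The integrand of [quadrature_weight] as a formal polynomial, so that degree bounds and root
    counting apply. *)
Definition lagrange_basis (i : 'I_s) : {poly R} :=
  \prod_(j < s | j != i) ((c i - c j)^-1 *: ('X - (c j)%:P)).

Lemma quadrature_weightE i :
  quadrature_weight c i = poly_int01 (lagrange_basis i).
Proof.
apply: eq_Rintegral => x _; rewrite horner_prod; apply: eq_bigr => j _.
by rewrite hornerZ hornerXsubC mulrC.
Qed.

Lemma lagrange_basis_node i j : (lagrange_basis i).[c j] = (i == j)%:R.
Proof.
have [cI _] := cG.
rewrite horner_prod; have [<-|ij] := eqVneq i j.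
  rewrite big1// => k ki; rewrite hornerZ hornerXsubC mulVf// subr_eq0.
  by apply: contra ki => /eqP/cI ->.
by rewrite (bigD1 j) 1?eq_sym//= hornerZ hornerXsubC subrr mulr0 mul0r.
Qed.

Lemma size_lagrange_basis i : (size (lagrange_basis i) <= s)%N.
Proof.
rewrite (leq_trans (size_prod_leq _ _))//=.
have sum_size : (\sum_(j < s | j != i) size ((c i - c j)^-1 *: ('X - (c j)%:P)) <=
    \sum_(j < s | j != i) 2)%N.
  by apply: leq_sum => j _; rewrite (leq_trans (size_scale_leq _ _))// size_XsubC.
have n1 : #|(fun j : 'I_s => j != i)| = s.-1.
  by have := cardC1 i; rewrite card_ord => <-; exact: eq_card.
move: sum_size; rewrite sum_nat_const n1; move: (\sum_(j < s | _) _)%N => m.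
(* The index [i] forces [0 < s], so that [s.-1] factors of size at most 2 give a product of size at
   most [s]. *)
have := ltn_ord i; lia.
Qed.

(** The difference of the two sides has size at most [s] and vanishes at [s] distinct nodes. *)
Lemma lagrange_interpolation (p : {poly R}) : (size p <= s)%N ->
  p = \sum_(i < s) p.[c i] *: lagrange_basis i.
Proof.
move=> sp; have [cI _] := cG.
apply/eqP; rewrite -subr_eq0; apply/eqP.
apply: (@roots_geq_poly_eq0 _ _ (codom c)).
- apply/allP => _ /codomP[j ->]; rewrite /root hornerD hornerN horner_sum.
  rewrite (bigD1 j)//= hornerZ lagrange_basis_node eqxx mulr1 big1 ?addr0 ?subrr//.
  by move=> i ij; rewrite hornerZ lagrange_basis_node (negbTE ij) mulr0.
- by rewrite codomE map_inj_uniq ?enum_uniq.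
- rewrite size_codom card_ord (leq_trans (size_polyD _ _))// size_polyN geq_max sp.
  apply: (leq_trans (size_sum _ _ _)).
  apply/bigmax_leqP => i _.
  by rewrite (leq_trans (size_scale_leq _ _))// size_lagrange_basis.
Qed.

(* Dividing by the Legendre polynomial leaves a remainder of degree < s with the
   same values at the nodes and, by orthogonality, the same integral. *)
Lemma gauss_quadrature_exact (p : {poly R}) : (size p <= s + s)%N ->
  poly_int01 p = \sum_(i < s) quadrature_weight c i * p.[c i].
Proof.
move=> sp; have [_ cR] := cG; set P : {poly R} := shifted_legendre s.
have sP : size P = s.+1 := size_shifted_legendre s.
have P0 : P != 0 by rewrite -size_poly_eq0 sP.
have Ep := divp_eq p P.
have pc i : p.[c i] = (p %% P).[c i].
  rewrite {1}Ep hornerD hornerM; have /eqP -> : root P (c i) by apply/cR; exists i.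
  by rewrite mulr0 add0r.
rewrite {1}Ep poly_int01D shifted_legendre_orthogonal ?add0r; last first.
  (* This is where the bound [s + s] comes from: the quotient has size at most [s], as orthogonality
     demands. *)
  by rewrite size_divp// sP /= leq_subLR.
have sr : (size (p %% P)%R <= s)%N by rewrite -ltnS -sP ltn_modp.
rewrite {1}(lagrange_interpolation _ sr) poly_int01_sum.
by apply: eq_bigr => i _; rewrite poly_int01Z quadrature_weightE mulrC pc.
Qed.

Lemma gauss_weight_ge0 i : 0 <= quadrature_weight c i.
Proof.
suff -> : quadrature_weight c i = poly_int01 (lagrange_basis i ^+ 2).
  by apply: poly_int01_ge0 => x; rewrite horner_exp sqr_ge0.
rewrite gauss_quadrature_exact; last first.
  rewrite (leq_trans (size_poly_exp_leq _ _))//.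
  have := size_lagrange_basis i; have := ltn_ord i; lia.
rewrite (bigD1 i)//= horner_exp lagrange_basis_node eqxx expr1n mulr1.
rewrite big1 ?addr0// => j ji.
by rewrite horner_exp lagrange_basis_node eq_sym (negbTE ji) expr0n mulr0.
Qed.

(** The substitution [y -> x + y * h] carries the step to the unit interval. The chain rule produces
    the factor [h], and differentiation brings the size down to [s + s], where the quadrature is
    exact. *)
Lemma gauss_quadrature_increment (p : {poly R}) (x h : R) :
  (size p <= (s + s).+1)%N ->
  p.[x + h] - p.[x] =
  h * \sum_(i < s) quadrature_weight c i * p^`().[x + c i * h].
Proof.
move=> sp; pose r := p \Po (x%:P + h *: 'X).
have rE y : r.[y] = p.[x + y * h].
  by rewrite horner_comp hornerD hornerC hornerZ hornerX mulrC.
have r'E y : r^`().[y] = h * p^`().[x + y * h].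
  rewrite deriv_comp hornerM horner_comp derivD derivC derivZ derivX add0r.
  by rewrite hornerD hornerC !hornerZ hornerX hornerC mulr1 mulrC [y * h]mulrC.
have sr : (size r^`() <= s + s)%N.
  have [->|r0] := eqVneq r 0; first by rewrite deriv0 size_poly0.
  rewrite -ltnS (leq_trans (lt_size_deriv r0))//.
  rewrite (leq_trans (size_comp_poly_leq _ _))//.
  have sA : (size (x%:P + h *: 'X)%R <= 2)%N.
    rewrite (leq_trans (size_polyD _ _))// geq_max.
    rewrite (leq_trans (size_polyC_leq1 _))//.
    by rewrite (leq_trans (size_scale_leq _ _))// size_polyX.
  by nia.
have -> : p.[x + h] = r.[1] by rewrite rE mul1r.
have -> : p.[x] = r.[0] by rewrite rE mul0r addr0.
rewrite -poly_int01_deriv gauss_quadrature_exact// mulr_sumr.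
by apply: eq_bigr => i _; rewrite r'E mulrCA.
Qed.

End gauss.

(** * Bilinearity of the inner product, and linear operators known up to null sets *)

Section L2_inner.
Context {R : realType} {d : measure_display} {T : measurableType d}.
Variable mu : {measure set T -> \bar R}.
Local Notation L2 := (Lfun mu 2%:E).
Implicit Types (f g h : T -> R) (a : R).

Lemma L2_axpy a f g : f \in L2 -> g \in L2 -> (fun x => a * f x + g x) \in L2.
Proof.
have p1 : (1 <= 2%:E :> \bar R)%E by rewrite lee_fin ler1n.
by move=> fL gL; exact: ((Lfun_submod_closed mu p1).2 a f g fL gL).
Qed.

Lemma L2_cst0 : (fun=> 0) \in L2.
Proof.
have p1 : (1 <= 2%:E :> \bar R)%E by rewrite lee_fin ler1n.
exact: (Lfun_submod_closed mu p1).1.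
Qed.

Lemma L2_lincomb n (e : 'I_n -> R) (b : 'I_n -> T -> R) :
  (forall k, b k \in L2) -> (fun x => \sum_(k < n) e k * b k x) \in L2.
Proof.
elim: n e b => [|n IHn] e b bL.
  by under eq_fun do rewrite big_ord0; exact: L2_cst0.
under eq_fun do rewrite big_ord_recl.
by apply: L2_axpy => //; exact: IHn.
Qed.

Lemma L2_measurable f : f \in L2 -> measurable_fun setT f.
Proof. by rewrite inE => /andP[/[!inE]]. Qed.

(** Hölder's inequality with exponents 2 and 2; the bilinearity of [inner] rests on this
    integrability. *)
Lemma L2_integrable_mul f g : f \in L2 -> g \in L2 ->
  mu.-integrable setT (EFin \o (f \* g)).
Proof. by move=> fL gL; apply/Lfun1_integrable; exact: Lfun2_mul_Lfun1. Qed.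

Lemma innerC f g : inner mu f g = inner mu g f.
Proof. by apply: eq_Rintegral => x _; rewrite mulrC. Qed.

Lemma inner_axpyl a f g h : f \in L2 -> g \in L2 -> h \in L2 ->
  inner mu (fun x => a * f x + g x) h = a * inner mu f h + inner mu g h.
Proof.
move=> fL gL hL; have fh := L2_integrable_mul _ _ fL hL.
rewrite /inner -RintegralZl// -RintegralD//; last exact: L2_integrable_mul.
  by apply: eq_Rintegral => x _; rewrite mulrDl mulrA.
exact: (integrableZl measurableT a fh).
Qed.

Lemma inner0l h : inner mu (fun=> 0) h = 0.
Proof.
rewrite /inner; under eq_Rintegral do rewrite mul0r.
by rewrite Rintegral_cst// mul0r.
Qed.

Lemma inner_scalel a f h : f \in L2 -> h \in L2 ->
  inner mu (fun x => a * f x) h = a * inner mu f h.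
Proof.
move=> fL hL; rewrite -[RHS]addr0 -(inner0l h) -inner_axpyl ?L2_cst0//.
by under [in RHS]eq_fun do rewrite addr0.
Qed.

Lemma inner_sumr n (e : 'I_n -> R) (b : 'I_n -> T -> R) h :
  (forall k, b k \in L2) -> h \in L2 ->
  inner mu h (fun x => \sum_(k < n) e k * b k x) =
  \sum_(k < n) e k * inner mu h (b k).
Proof.
move=> bL hL; elim: n e b bL => [|n IHn] e b bL.
  by under eq_fun do rewrite big_ord0; rewrite big_ord0 innerC inner0l.
under eq_fun do rewrite big_ord_recl.
rewrite innerC inner_axpyl//; last exact: L2_lincomb.
by rewrite big_ord_recl innerC [in X in _ + X]innerC IHn.
Qed.

(** Linearity of the operator, the initial condition and the equation for [u] hold only almost
    everywhere; this lets them be used inside [inner]. *)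
Lemma inner_ae f f' g g' : f \in L2 -> f' \in L2 -> g \in L2 -> g' \in L2 ->
  f = f' %[ae mu] -> g = g' %[ae mu] -> inner mu f g = inner mu f' g'.
Proof.
move=> fL f'L gL g'L ff' gg'.
rewrite /inner /Rintegral (@ae_eq_integral _ _ _ mu setT
  (EFin \o (f' \* g')) (EFin \o (f \* g)))//.
- by apply/measurable_EFinP; apply: measurable_funM; exact: L2_measurable.
- by apply/measurable_EFinP; apply: measurable_funM; exact: L2_measurable.
- by apply: filterS2 ff' gg' => x /= E1 E2 _; rewrite E1// E2.
Qed.

Variables (D : set (T -> R)) (A : (T -> R) -> T -> R).
Hypotheses (A_op : L2_operator mu D A) (A_lin : linear_operator mu D A).

Lemma operator_dom_lincomb n (e : 'I_n -> R) (b : 'I_n -> T -> R) :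
  (forall k, D (b k)) -> D (fun x => \sum_(k < n) e k * b k x).
Proof.
elim: n e b => [|n IHn] e b bD.
  by under eq_fun do rewrite big_ord0; exact: linear_operator_dom0 A_lin.
under eq_fun do rewrite big_ord_recl.
by apply: (linear_operator_dom A_lin) => //; exact: IHn.
Qed.

Lemma inner_operator_axpy a f g h : D f -> D g -> h \in L2 ->
  inner mu (A (fun x => a * f x + g x)) h =
  a * inner mu (A f) h + inner mu (A g) h.
Proof.
move=> fD gD hL; have [_ AL _ _] := A_op.
rewrite -inner_axpyl ?AL//; apply: inner_ae => //.
- by apply: AL; exact: (linear_operator_dom A_lin).
- by apply: L2_axpy; exact: AL.
- exact: (linear_operatorP A_lin).
- exact: ae_eq_refl.
Qed.

Lemma inner_operator0 h : h \in L2 -> inner mu (A (fun=> 0)) h = 0.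
Proof.
move=> hL; have D0 := linear_operator_dom0 A_lin.
(* With coefficient -1 and both functions zero, the right side cancels while the left side is the
   wanted term. *)
have := inner_operator_axpy (-1) _ _ _ D0 D0 hL.
by under eq_fun do rewrite mulr0 addr0; rewrite mulN1r addNr.
Qed.

Lemma inner_operator_sum n (e : 'I_n -> R) (b : 'I_n -> T -> R) h :
  (forall k, D (b k)) -> h \in L2 ->
  inner mu (A (fun x => \sum_(k < n) e k * b k x)) h =
  \sum_(k < n) e k * inner mu (A (b k)) h.
Proof.
move=> bD hL; elim: n e b bD => [|n IHn] e b bD.
  by under eq_fun do rewrite big_ord0; rewrite big_ord0 inner_operator0.
under eq_fun do rewrite big_ord_recl.
rewrite inner_operator_axpy//; last exact: operator_dom_lincomb.
by rewrite big_ord_recl IHn.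
Qed.

End L2_inner.

(** * The energy as a real polynomial in time *)

Section energy_polynomial.
Context {R : realType}.
Implicit Types (v : {poly R}) (t C : R).

(** [M k l] stands for the inner product of [L (a k)] and [a l], where the [a k] are the
    coefficients of [u]. *)
Definition energy_poly n (M : 'I_n -> 'I_n -> R) v C : {poly R} :=
  2^-1 *: (\sum_(k < n) \sum_(l < n) M k l *: ('X^k * 'X^l)) + v ^+ 2 - C%:P.

Lemma size_energy_poly s (M : 'I_s.+1 -> 'I_s.+1 -> R) v C :
  (size v <= s.+1)%N -> (size (energy_poly _ M v C) <= (s + s).+1)%N.
Proof.
move=> sv; rewrite (leq_trans (size_polyD _ _))// geq_max size_polyN.
rewrite (leq_trans (size_polyC_leq1 _))// andbT.
rewrite (leq_trans (size_polyD _ _))// geq_max; apply/andP; split; last first.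
  by rewrite (leq_trans (size_poly_exp_leq _ _))//; lia.
rewrite (leq_trans (size_scale_leq _ _))// (leq_trans (size_sum _ _ _))//.
apply/bigmax_leqP => k _; rewrite (leq_trans (size_sum _ _ _))//.
apply/bigmax_leqP => l _; rewrite (leq_trans (size_scale_leq _ _))//.
by rewrite -exprD size_polyXn ltnS leq_add// -ltnS.
Qed.

Lemma horner_energy_poly n (M : 'I_n -> 'I_n -> R) v C t :
  (energy_poly _ M v C).[t] =
  2^-1 * (\sum_(k < n) t ^+ k * \sum_(l < n) t ^+ l * M k l) + v.[t] ^+ 2 - C.
Proof.
rewrite /energy_poly !hornerE horner_sum; do 2 congr (_ + _).
congr (_ * _); apply: eq_bigr => k _; rewrite horner_sum mulr_sumr.
by apply: eq_bigr => l _; rewrite hornerZ hornerM !hornerXn; ring.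
Qed.

(** The product rule splits the double sum in two; symmetry of [M] makes the halves equal, which
    absorbs the factor [2^-1]. *)
Lemma horner_deriv_energy_poly n (M : 'I_n -> 'I_n -> R) v C t :
  (forall k l, M k l = M l k) ->
  (energy_poly _ M v C)^`().[t] =
  (\sum_(k < n) t ^+ k * \sum_(l < n) ('X^l)^`().[t] * M k l) +
  2 * (v.[t] * v^`().[t]).
Proof.
move=> Msym; rewrite /energy_poly derivB derivC subr0 derivD derivZ expr2 derivM.
rewrite hornerD hornerZ; congr (_ + _); last first.
  by rewrite hornerD !hornerM; ring.
rewrite raddf_sum horner_sum /=.
set S := RHS.
have -> : \sum_(k < n) (\sum_(l < n) M k l *: ('X^k * 'X^l))^`().[t] = S + S.
  rewrite {1}/S; under [X in _ = X + _]eq_bigr do rewrite mulr_sumr.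
  (* Only one copy of [S] has its summations exchanged; it accounts for the terms where ['X^k] is
     differentiated. *)
  rewrite [X in _ = X + _]exchange_big -big_split/=; apply: eq_bigr => k _.
  rewrite raddf_sum horner_sum /= mulr_sumr -big_split/=; apply: eq_bigr => l _.
  by rewrite derivZ derivM hornerZ hornerD !hornerM !hornerXn [M l k]Msym; ring.
by field.
Qed.

End energy_polynomial.

(** * Time derivative of a function-valued polynomial *)

Section time_derivative.
Context {R : realType} {d : measure_display} {T : measurableType d}.

(** At a fixed point [x], [u ^~ x] is evaluation of a real polynomial, so the analytic derivative is
    the formal one. *)
Lemma dt_fun_poly n (a : 'I_n -> T -> R) (u : R -> T -> R) t :
  (forall t x, u t x = \sum_(k < n) t ^+ k * a k x) ->
  dt_fun u t = fun x => \sum_(k < n) ('X^k)^`().[t] * a k x.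
Proof.
move=> uE; apply/funext => x; rewrite /dt_fun.
have -> : u ^~ x = horner (\sum_(k < n) a k x *: 'X^k).
  apply/funext => y; rewrite uE horner_sum; apply: eq_bigr => k _.
  by rewrite hornerZ hornerXn mulrC.
rewrite -derivE raddf_sum horner_sum; apply: eq_bigr => k _.
by rewrite /= derivZ hornerZ mulrC.
Qed.

End time_derivative.

(** * The energy along a collocation polynomial *)

Section hsav_energy.
Context {R : realType} {d : measure_display} {T : measurableType d}.
Variables (mu : {measure set T -> \bar R}).
Variables (DL : set (T -> R)) (L : (T -> R) -> T -> R) (C0 : R).
Hypotheses (L_op : L2_operator mu DL L) (L_lin : linear_operator mu DL L).
Hypothesis L_sa : self_adjoint mu DL L.
Variables (n : nat) (a : 'I_n -> T -> R) (u : R -> T -> R).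
Hypothesis aD : forall k, DL (a k).
Hypothesis uE : forall t x, u t x = \sum_(k < n) t ^+ k * a k x.

Let M k l := inner mu (L (a k)) (a l).

Lemma time_poly_dom t : DL (u t).
Proof.
rewrite (_ : u t = fun x => \sum_(k < n) t ^+ k * a k x); last exact/funext.
exact: (operator_dom_lincomb _ _ _ L_lin).
Qed.

Lemma dt_fun_L2 t : dt_fun u t \in Lfun mu 2%:E.
Proof.
rewrite (dt_fun_poly _ _ _ _ uE); apply: L2_lincomb => k.
exact: (L2_operator_dom L_op).
Qed.

(** The coefficients [e] are left free to cover both [u t], for the energy, and [dt_fun u t], for
    its derivative. *)
Lemma inner_operator_time_poly t (e : 'I_n -> R) (h : T -> R) :
  h = (fun x => \sum_(l < n) e l * a l x) ->
  inner mu (L (u t)) h = \sum_(k < n) t ^+ k * \sum_(l < n) e l * M k l.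
Proof.
have aL k : a k \in Lfun mu 2%:E by exact: (L2_operator_dom L_op).
move=> ->; rewrite (_ : u t = fun x => \sum_(k < n) t ^+ k * a k x); last exact/funext.
rewrite (inner_operator_sum _ _ _ L_op L_lin)//; last exact: L2_lincomb.
apply: eq_bigr => k _; congr (_ * _).
by rewrite inner_sumr//; exact: (L2_operator_val L_op).
Qed.

Lemma energy_time_poly (v : {poly R}) t :
  energy mu L C0 (u t) v.[t] = (energy_poly _ M v C0).[t].
Proof.
rewrite horner_energy_poly /energy.
by rewrite (inner_operator_time_poly t (fun l => t ^+ l))//; exact/funext.
Qed.

Lemma deriv_energy_time_poly (v : {poly R}) t :
  (energy_poly _ M v C0)^`().[t] =
  inner mu (L (u t)) (dt_fun u t) + 2 * (v.[t] * v^`().[t]).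
Proof.
rewrite horner_deriv_energy_poly; last first.
  (* Self-adjointness of [L] enters here, as the symmetry of [M]. *)
  by move=> k l; rewrite /M L_sa// innerC.
by rewrite (inner_operator_time_poly t (fun l => ('X^l)^`().[t]))//; exact: dt_fun_poly.
Qed.

Lemma energy_ae phi psi q : DL phi -> DL psi -> phi = psi %[ae mu] ->
  energy mu L C0 phi q = energy mu L C0 psi q.
Proof.
move=> phiD psiD E; rewrite /energy; congr (_ * _ + _ - _).
have [DL2 LL2 _ Lae] := L_op.
by apply: inner_ae => //; [exact: LL2|exact: LL2|exact: DL2|exact: DL2|exact: Lae].
Qed.

End hsav_energy.

Theorem theorem3p2 (R : realType) (d : measure_display) (T : measurableType d)
    (mu : {measure set T -> \bar R})
    (DL : set (T -> R)) (L : (T -> R) -> T -> R)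
    (DG : set (T -> R)) (G : (T -> R) -> T -> R)
    (g : R -> R) (C0 : R)
    (L_op : L2_operator mu DL L) (L_lin : linear_operator mu DL L)
    (L_sa : self_adjoint mu DL L)
    (G_op : L2_operator mu DG G) (G_nsd : negative_semidefinite mu DG G)
    (g_diff : forall x : R, derivable g x 1) (C0_gt0 : 0 < C0)
    (s : nat) (s_ge1 : (1 <= s)%N)
    (c : 'I_s -> R) (c_gauss : gauss_nodes c)
    (tn dt : R) (dt_gt0 : 0 < dt)
    (phin : T -> R) (phin_L2 : phin \in Lfun mu 2%:E) (qn : R)
    (u : R -> T -> R) (v : {poly R})
    (uv_hsav : hsav_collocation mu DL L DG G g C0 c tn dt phin qn u v) :
  let phin1 := u (tn + dt) in
  let qn1 := v.[tn + dt] in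
  let b := quadrature_weight c in
  let w i := let t := stage tn dt c i in
             chemical_potential mu L g C0 (u t) v.[t] in
  let dissipation := dt * \sum_(i < s) b i * inner mu (w i) (G (w i)) in
  [/\ forall i, 0 <= b i,
      energy mu L C0 phin1 qn1 - energy mu L C0 phin qn = dissipation
    & dissipation <= 0].
Proof.
move=> phin1 qn1 b w dissipation.
have b_ge0 i : 0 <= b i by exact: gauss_weight_ge0.
have diss_le0 : dissipation <= 0.
  rewrite /dissipation pmulr_rle0// -oppr_ge0 -sumrN sumr_ge0// => i _.
  rewrite oppr_ge0 mulr_ge0_le0//; apply: G_nsd.
  exact: (hsav_dom uv_hsav i).
split=> //.
have [a [aD uE]] := hsav_u_poly uv_hsav.
have uD := time_poly_dom _ _ _ L_lin _ _ _ aD uE.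
have uL2 := dt_fun_L2 _ _ _ L_op _ _ _ aD uE.
(* [phin] is only given in L^2; it inherits membership in [DL] from [u tn], to which it is equal
   almost everywhere. *)
have phinD : DL phin.
  exact: (L2_operator_dom_ae L_op (uD tn) phin_L2 (hsav_u_init uv_hsav)).
have -> : energy mu L C0 phin qn = energy mu L C0 (u tn) v.[tn].
  rewrite (hsav_v_init uv_hsav); apply: (energy_ae _ _ _ _ L_op) => //.
  exact: ae_eq_sym (hsav_u_init uv_hsav).
rewrite /phin1 /qn1 !(energy_time_poly _ _ _ _ L_op L_lin _ _ _ aD uE).
rewrite (gauss_quadrature_increment _ _ c_gauss); last first.
  by apply: size_energy_poly; exact: hsav_v_poly uv_hsav.
(* Both sides are now quadrature sums with the same weights, so it suffices to compare them node by
   node. *)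
rewrite /dissipation; congr (_ * _); apply: eq_bigr => i _; congr (_ * _).
rewrite -/(stage tn dt c i) (deriv_energy_time_poly _ _ _ _ L_op L_lin L_sa _ _ _ aD uE).
have wD : DG (w i) := hsav_dom uv_hsav i.
have LuL : L (u (stage tn dt c i)) \in Lfun mu 2%:E by exact: (L2_operator_val L_op).
have dgL := hsav_dg_L2 uv_hsav i.
have -> : inner mu (w i) (G (w i)) = inner mu (w i) (dt_fun u (stage tn dt c i)).
  apply: inner_ae => //.
  - exact: (L2_operator_dom G_op wD).
  - exact: (L2_operator_dom G_op wD).
  - exact: (L2_operator_val G_op wD).
  - exact: ae_eq_refl.
  - exact: ae_eq_sym (hsav_u_eq uv_hsav i).
rewrite (hsav_v_eq uv_hsav i) /w /chemical_potential /=.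
set t := stage tn dt c i; set r := sav_root mu g C0 (u t).
rewrite -/t in LuL dgL.
(* Both functions are put in the shape expected by [inner_axpyl] and [inner_scalel]. The factor 2
   from the derivative of [v ^+ 2] then cancels the 2 in the equation for [v]. *)
have -> : (fun x => L (u t) x + v.[t] * derive1 g (u t x) / r) =
          (fun x => v.[t] / r * (derive1 g \o u t) x + L (u t) x).
  by apply/funext => x /=; rewrite addrC mulrAC.
have -> : (fun x => derive1 g (u t x) / (2 * r)) =
          (fun x => (2 * r)^-1 * (derive1 g \o u t) x).
  by apply/funext => x /=; rewrite mulrC.
rewrite inner_axpyl// inner_scalel// addrC invfM; congr (_ + _).
(* With [r^-1] made an atom, the only denominator left for [field] is 2. *)
by move: r^-1 => ri; field.
Qed.
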